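(* Let $\beta=(\beta_n)$ be a nonnegative sequence and let $a=(a_n)\in GM(\beta,2)$. Suppose that $$\sum_{k=[n/2]}^{2n-1}\frac{\beta_k+\beta_{2k}+|a_k|+|a_{k+1}|}{2k-n+2}=o(1)\qquad(n\to\infty).$$ Then $\|V_n(f)-S_n(f)\|=o(1)$ as $n\to\infty$.
   Context: $\mathbb{N}=\{1,2,\dots\}$ and $[t]$ is the integer part of $t$. For a nonnegative sequence $\beta=(\beta_n)$ and $r\in\mathbb{N}$, a sequence of complex numbers $(a_n)$ belongs to $GM(\beta,r)$ (is $(\beta,r)$-general monotone) if there is a constant $C$ such that $\sum_{n=m}^{2m-1}|a_n-a_{n+r}|\le C\beta_m$ for all $m\in\mathbb{N}$. The norm is $\|F\|=\frac1{2\pi}\int_{-\pi}^{\pi}|F(x)|\,dx$. The symbol $f$ refers to the cosine series $\frac{a_0}{2}+\sum_{k=1}^{\infty}a_k\cos kx$ ($a_0\in\mathbb{C}$), with partial sums $S_n(f,x)=\frac{a_0}{2}+\sum_{k=1}^{n}a_k\cos kx$, and $V_n(f,x)=\frac1{n+1}\sum_{k=0}^{n}S_k(f,x)$. *)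

(* Defs.v *)
From Stdlib Require Import Reals Arith.
From Coquelicot Require Import Coquelicot.
Open Scope R_scope.

(** Sequences indexed by {1,2,...} are functions on [nat]: entry [0] of [beta]
    is never constrained, and entry [0] of [a] is the free constant coefficient
    of the cosine series. *)

Definition nonneg_seq (beta : nat -> R) : Prop :=
  forall n : nat, (1 <= n)%nat -> 0 <= beta n.

Definition GM (beta : nat -> R) (r : nat) (a : nat -> C) : Prop :=
  exists K : R, forall m : nat, (1 <= m)%nat ->
    sum_n_m (fun n => Cmod (a n - a (n + r)%nat)%C) m (2 * m - 1)
      <= K * beta m.

(** Applied only to continuous [F], for which the Riemann and Lebesgue
    integrals agree. *)
Definition L1norm (F : R -> C) : R :=
  / (2 * PI) * RInt (fun x => Cmod (F x)) (- PI) PI.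

Definition cos_partial_sum (a : nat -> C) (n : nat) (x : R) : C :=
  (a 0%nat / 2 +
     sum_n_m (fun k => (a k * RtoC (cos (INR k * x)))%C) 1 n)%C.

Definition cos_fejer_mean (a : nat -> C) (n : nat) (x : R) : C :=
  (RtoC (/ (INR n + 1)) *
     sum_n_m (fun k => cos_partial_sum a k x) 0 n)%C.

(* Main.v *)
Require Import Defs.
From Stdlib Require Import Reals Arith Lra Lia.
From Coquelicot Require Import Coquelicot.
Open Scope R_scope.

(** The difference [S_n - V_n] equals [T_n / (n+1)], where [T_n] is the sum of
    [k a_k cos kx] over [1 <= k <= n] ([partial_minus_fejer]), so one has to
    show that the integral [t_n] of [|T_n|] over a period is [o(n)].  Splitting
    [T_n] at [h = n/2] gives [t_n <= t_(n/2) + (integral of the upper block)];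
    if the upper block contributes [o(n)], summing the resulting geometric
    series gives [t_n = o(n)] ([halving_little_o]).

    The upper block is estimated at a point [x] with [|sin x|] of size at least
    [1/p] by cutting it once more, at [m = h + p] ([block_integral_le]).  The
    [p - 1] terms before [m] are bounded trivially.  The terms from [m] on are
    summed by parts with step two, that is, after multiplication by [2 sin x]
    ([abel_step_two]); the differences [a_k - a_(k+2)] with [m <= k <= n] are
    exactly controlled by [K beta_m], because [n <= 2m - 1].  The set of points
    at which [1/p] is the right scale has measure of order [1/p^2]
    ([RInt_period_le]), so the [L^1] norm of the block is at most a constant
    times
      [n * (A log n + sum over p of beta_(h+p) / p)],
    where [A] bounds [|a_k|] for [h < k <= n + 2].

    The sum over [p] is controlled by the hypothesis, whose denominator
    [2k - n + 2] is comparable with [p] at [k = h + p] ([log_weighted_le]).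
    The hypothesis also forces [|a_k| log k -> 0] ([coefficient_log_le]): for
    [k/2 <= m <= k], general monotonicity bounds [|a_k|] by
    [|a_m| + |a_(m+1)| + K beta_m], and averaging over [m = k/2 + p] with
    weights [1/p] puts a factor [log k] in front of [|a_k|]. *)

(** * Finite sums *)

Lemma sum_C_last (u : nat -> C) (m n : nat) :
  (m <= S n)%nat -> sum_n_m u m (S n) = (sum_n_m u m n + u (S n))%C.
Proof. exact (sum_n_Sm u m n). Qed.

Lemma sum_R_last (u : nat -> R) (m n : nat) :
  (m <= S n)%nat -> sum_n_m u m (S n) = sum_n_m u m n + u (S n).
Proof. exact (sum_n_Sm u m n). Qed.

Lemma sum_R_empty (u : nat -> R) (m n : nat) :
  (n < m)%nat -> sum_n_m u m n = 0.
Proof. exact (sum_n_m_zero u m n). Qed.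

Lemma sum_C_empty (u : nat -> C) (m n : nat) :
  (n < m)%nat -> sum_n_m u m n = RtoC 0.
Proof. exact (sum_n_m_zero u m n). Qed.

Lemma sum_R_Chasles (u : nat -> R) (m p n : nat) :
  (m <= S p)%nat -> (p <= n)%nat ->
  sum_n_m u m n = sum_n_m u m p + sum_n_m u (S p) n.
Proof. exact (sum_n_m_Chasles u m p n). Qed.

Lemma sum_R_first (u : nat -> R) (m n : nat) :
  (m <= n)%nat -> sum_n_m u m n = u m + sum_n_m u (S m) n.
Proof. exact (sum_Sn_m u m n). Qed.

Lemma sum_C_Chasles (u : nat -> C) (m p n : nat) :
  (m <= S p)%nat -> (p <= n)%nat ->
  sum_n_m u m n = (sum_n_m u m p + sum_n_m u (S p) n)%C.
Proof. exact (sum_n_m_Chasles u m p n). Qed.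

Lemma sum_R_scal (l : R) (u : nat -> R) (m n : nat) :
  sum_n_m (fun k => l * u k) m n = l * sum_n_m u m n.
Proof. exact (sum_n_m_mult_l l u m n). Qed.

Lemma sum_R_plus (u v : nat -> R) (m n : nat) :
  sum_n_m (fun k => u k + v k) m n = sum_n_m u m n + sum_n_m v m n.
Proof. exact (sum_n_m_plus u v m n). Qed.

Lemma Cmod_sum_le (u : nat -> C) (m n : nat) :
  Cmod (sum_n_m u m n) <= sum_n_m (fun k => Cmod (u k)) m n.
Proof. exact (norm_sum_n_m (V := C_NormedModule) u m n). Qed.

Lemma sum_R_le (u v : nat -> R) (m n : nat) :
  (forall k, (m <= k <= n)%nat -> u k <= v k) ->
  sum_n_m u m n <= sum_n_m v m n.
Proof.
intros H; induction n as [|n IH].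
- destruct m; [rewrite !sum_n_n; apply H; lia|].
  rewrite !sum_R_empty by lia; lra.
- destruct (le_lt_dec m (S n)) as [Hm|Hm].
  + rewrite !sum_R_last by lia; apply Rplus_le_compat.
    * apply IH; intros; apply H; lia.
    * apply H; lia.
  + rewrite !sum_R_empty by lia; lra.
Qed.

Lemma sum_R_nonneg (u : nat -> R) (m n : nat) :
  (forall k, (m <= k <= n)%nat -> 0 <= u k) -> 0 <= sum_n_m u m n.
Proof.
intros H; replace 0 with (sum_n_m (fun _ => 0) m n).
- now apply sum_R_le.
- exact (sum_n_m_const_zero m n).
Qed.

Lemma sum_R_shift (f : nat -> R) (h P : nat) :
  sum_n_m (fun p => f (h + p)%nat) 1 P = sum_n_m f (h + 1) (h + P).
Proof.
induction P as [|P IH].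
- now rewrite !sum_R_empty by lia.
- rewrite sum_R_last, IH by lia.
  replace (h + S P)%nat with (S (h + P)) by lia.
  now rewrite sum_R_last by lia.
Qed.

(** The values of a sum over [C] are typed in the carrier of an abelian monoid;
    the equation has to be restated in [C] before [ring] can normalise it. *)
Ltac C_ring := lazymatch goal with |- ?u = ?v => change (@eq C u v) end; ring.

(** * Cosine sums *)

Definition cos_sum (c : nat -> C) (m n : nat) (x : R) : C :=
  sum_n_m (fun k => (c k * RtoC (cos (INR k * x)))%C) m n.

Lemma continuous_Cmod_cos_sum (c : nat -> C) (m n : nat) (x : R) :
  continuous (fun y => Cmod (cos_sum c m n y)) x.
Proof.
assert (Hcos : forall k, continuous (fun y => cos (INR k * y)) x).
{ intros k; apply (ex_derive_continuous (V := R_NormedModule)); auto_derive; auto. }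
assert (H : continuous (fun y => fst (cos_sum c m n y)) x /\
            continuous (fun y => snd (cos_sum c m n y)) x).
{ assert (Hterm : forall k,
    continuous (fun y => fst (c k * RtoC (cos (INR k * y)))%C) x /\
    continuous (fun y => snd (c k * RtoC (cos (INR k * y)))%C) x).
  { intros k; split.
    - apply (continuous_ext (fun y => scal (fst (c k)) (cos (INR k * y)))).
      + intros y; unfold scal; simpl; unfold mult; simpl; ring.
      + apply (continuous_scal_r (V := R_NormedModule)), Hcos.
    - apply (continuous_ext (fun y => scal (snd (c k)) (cos (INR k * y)))).
      + intros y; unfold scal; simpl; unfold mult; simpl; ring.
      + apply (continuous_scal_r (V := R_NormedModule)), Hcos. }
  unfold cos_sum; induction n as [|n IH].
  - destruct m.
    + split; [apply (continuous_ext (fun y => fst (c 0%nat * RtoC (cos (INR 0 * y)))%C))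
             |apply (continuous_ext (fun y => snd (c 0%nat * RtoC (cos (INR 0 * y)))%C))];
      try apply Hterm; intros y; now rewrite sum_n_n.
    + split; apply (continuous_ext (fun y => 0));
      try (intros y; now rewrite sum_C_empty by lia); apply continuous_const.
  - destruct (le_lt_dec m (S n)) as [Hm|Hm].
    + destruct IH as [IH1 IH2]; destruct (Hterm (S n)) as [T1 T2].
      split.
      * eapply continuous_ext;
        [|apply (continuous_plus (V := R_NormedModule) _ _ _ IH1 T1)].
        intros y; now rewrite sum_C_last by lia.
      * eapply continuous_ext;
        [|apply (continuous_plus (V := R_NormedModule) _ _ _ IH2 T2)].
        intros y; now rewrite sum_C_last by lia.
    + split; apply (continuous_ext (fun y => 0));
      try (intros y; now rewrite sum_C_empty by lia); apply continuous_const. }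
destruct H as [H1 H2]; unfold Cmod.
apply (continuous_comp
  (fun y => fst (cos_sum c m n y) ^ 2 + snd (cos_sum c m n y) ^ 2) sqrt).
- apply (continuous_ext (fun y =>
    plus (mult (fst (cos_sum c m n y)) (fst (cos_sum c m n y)))
         (mult (snd (cos_sum c m n y)) (snd (cos_sum c m n y))))).
  + intros y; unfold plus, mult; simpl; ring.
  + apply (continuous_plus (V := R_NormedModule));
    now apply (continuous_mult (K := R_AbsRing)).
- apply continuous_sqrt.
Qed.

(** In the mean of the [n + 1] partial sums the [k]-th term is missing [k]
    times, which leaves the coefficients [k a_k]. *)
Lemma partial_minus_fejer (a : nat -> C) (n : nat) (x : R) :
  (cos_fejer_mean a n x - cos_partial_sum a n x =
   - (RtoC (/ (INR n + 1)) * cos_sum (fun k => RtoC (INR k) * a k) 1 n x))%C.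
Proof.
assert (H : (sum_n_m (fun k => cos_partial_sum a k x) 0 n =
  RtoC (INR n + 1) * cos_partial_sum a n x
  - cos_sum (fun k => RtoC (INR k) * a k) 1 n x)%C).
{ induction n as [|n IH].
  - rewrite sum_n_n; unfold cos_sum; rewrite sum_C_empty by lia.
    simpl; rewrite Rplus_0_l; C_ring.
  - rewrite sum_C_last, IH by lia.
    unfold cos_sum, cos_partial_sum.
    rewrite !(sum_C_last _ 1 n) by lia.
    rewrite !RtoC_plus, !S_INR, !RtoC_plus; C_ring. }
unfold cos_fejer_mean; rewrite H, RtoC_inv.
- field; intros E; apply (RtoC_inj _ 0) in E; pose proof (pos_INR n); lra.
- pose proof (pos_INR n); lra.
Qed.

(** Summation by parts with step two: [2 sin x cos kx] is the difference of
    [sin (k+1)x] and [sin (k-1)x], two terms of the same sequence at distance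
    two, so [c_k - c_(k+2)] appears, with two boundary terms at each end.  Since
    [sin] also vanishes at [PI], step two deals with the singularities at [0]
    and [PI] simultaneously. *)
Lemma abel_step_two (c : nat -> C) (m n : nat) (x : R) :
  (m <= n)%nat ->
  (RtoC (2 * sin x) * cos_sum c m n x =
   sum_n_m (fun k => (c k - c (k + 2)%nat) * RtoC (sin ((INR k + 1) * x))) m n
   + (c (n + 1)%nat * RtoC (sin (INR n * x))
      + c (n + 2)%nat * RtoC (sin ((INR n + 1) * x)))
   - (c m * RtoC (sin ((INR m - 1) * x))
      + c (m + 1)%nat * RtoC (sin (INR m * x))))%C.
Proof.
assert (T : forall k, (RtoC (2 * sin x) * RtoC (cos (INR k * x)) =
   RtoC (sin ((INR k + 1) * x)) - RtoC (sin ((INR k - 1) * x)))%C).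
{ intros k; rewrite <- RtoC_mult, <- RtoC_minus; f_equal.
  replace ((INR k + 1) * x) with (INR k * x + x) by ring.
  replace ((INR k - 1) * x) with (INR k * x - x) by ring.
  rewrite sin_plus, sin_minus; ring. }
intros Hmn; induction n as [|n IH].
- replace m with 0%nat by lia; unfold cos_sum; rewrite !sum_n_n.
  transitivity (c 0%nat * (RtoC (2 * sin x) * RtoC (cos (INR 0 * x))))%C; [ring|].
  rewrite T; simpl; C_ring.
- destruct (le_lt_dec m n) as [Hm|Hm].
  + unfold cos_sum in *; rewrite !(sum_C_last _ m n) by lia.
    rewrite Cmult_plus_distr_l, IH by lia.
    replace (RtoC (2 * sin x) * (c (S n) * RtoC (cos (INR (S n) * x))))%C
      with (c (S n) * (RtoC (2 * sin x) * RtoC (cos (INR (S n) * x))))%C by ring.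
    rewrite T, S_INR.
    replace (S n + 1)%nat with (n + 2)%nat by lia.
    replace (S n) with (n + 1)%nat by lia.
    replace (INR n + 1 - 1) with (INR n) by ring.
    C_ring.
  + replace m with (S n) by lia; unfold cos_sum; rewrite !sum_n_n.
    transitivity (c (S n) * (RtoC (2 * sin x) * RtoC (cos (INR (S n) * x))))%C; [ring|].
    rewrite T; C_ring.
Qed.

(** * Integrals over a period *)

Lemma ex_RInt_continuous_everywhere (g : R -> R) (a b : R) :
  (forall x, continuous g x) -> ex_RInt g a b.
Proof. intros H; apply (ex_RInt_continuous (V := R_CompleteNormedModule)); auto. Qed.

(** From [sin x >= x - x^3/6] and [x <= PI/2 <= 2]. *)
Lemma third_le_sin (x : R) : 0 <= x <= PI / 2 -> x / 3 <= sin x.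
Proof.
intros [H0 H1]; pose proof PI_4; pose proof PI_RGT_0.
destruct (sin_bound x 0 H0 ltac:(lra)) as [Hs _].
unfold sin_approx, sin_term in Hs; simpl in Hs.
apply Rle_trans with (2 := Hs).
assert (Hx : x * x <= 4) by nra.
assert (0 <= x * (4 - x * x)) by (apply Rmult_le_pos; lra).
field_simplify; lra.
Qed.

Lemma RInt_le_const (g : R -> R) (a b B : R) :
  (forall x, continuous g x) -> a <= b ->
  (forall x, a < x < b -> g x <= B) -> RInt g a b <= (b - a) * B.
Proof.
intros Hg Hab HB.
replace ((b - a) * B) with (RInt (fun _ => B) a b)
  by (rewrite RInt_const; reflexivity).
apply RInt_le; trivial.
- now apply ex_RInt_continuous_everywhere.
- apply ex_RInt_const.
Qed.

(** On [[0, PI/2]] the points at scale [p] are those between [PI/2 / (p+1)] and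
    [PI/2 / p]: there [sin x >= x/3 >= PI/6 / (p+1) >= 1 / (3(p+1))], because
    [PI >= 2], and this interval has length [PI/2 / (p (p+1))].  The points
    closer to [0] than all these intervals are left to the uniform bound [B]. *)
Lemma RInt_quarter_le (g : R -> R) (P : nat) (b : nat -> R) (B : R) :
  (forall x, continuous g x) ->
  (forall p x, (1 <= p <= P)%nat -> / (3 * (INR p + 1)) <= Rabs (sin x) -> g x <= b p) ->
  (forall x, g x <= B) ->
  RInt g 0 (PI / 2) <=
    PI / 2 * (sum_n_m (fun p => b p / (INR p * (INR p + 1))) 1 P + B / (INR P + 1)).
Proof.
intros Hg Hb HB; pose proof PI_RGT_0 as HPI; pose proof PI2_1.
assert (Hint : forall u v, ex_RInt g u v)
  by (intros; now apply ex_RInt_continuous_everywhere).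
assert (Htail : forall Q, (Q <= P)%nat ->
  RInt g (PI / 2 / (INR Q + 1)) (PI / 2)
    <= PI / 2 * sum_n_m (fun p => b p / (INR p * (INR p + 1))) 1 Q).
{ induction Q as [|Q IH]; intros HQ.
  - rewrite sum_R_empty by lia; simpl.
    replace (PI / 2 / (0 + 1)) with (PI / 2) by field.
    rewrite RInt_point; apply Req_le; unfold zero; simpl; ring.
  - rewrite sum_R_last, Rmult_plus_distr_l by lia.
    pose proof (pos_INR Q) as HQ0; rewrite S_INR.
    rewrite <- (RInt_Chasles g _ (PI / 2 / (INR Q + 1)) (PI / 2)) by apply Hint.
    rewrite Rplus_comm; unfold plus; simpl; apply Rplus_le_compat; [apply IH; lia|].
    replace (PI / 2 * (b (S Q) / ((INR Q + 1) * (INR Q + 1 + 1)))) with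
      ((PI / 2 / (INR Q + 1) - PI / 2 / (INR Q + 1 + 1)) * b (S Q)) by (field; lra).
    apply RInt_le_const; trivial.
    + apply Rmult_le_compat_l; [lra|]; apply Rinv_le_contravar; lra.
    + intros x [Hx1 Hx2]; apply Hb; [lia|]; rewrite S_INR.
      assert (Hxle : x <= PI / 2).
      { apply Rlt_le, (Rlt_le_trans _ _ _ Hx2).
        apply Rmult_le_reg_r with (INR Q + 1); [lra|].
        unfold Rdiv; rewrite Rmult_assoc, Rinv_l by lra; nra. }
      assert (Hx0 : 0 < PI / 2 / (INR Q + 1 + 1)) by (apply Rdiv_lt_0_compat; lra).
      pose proof (third_le_sin x ltac:(lra)).
      rewrite Rabs_pos_eq by lra.
      apply Rle_trans with (x / 3); [|lra].
      apply Rle_trans with (PI / 2 / (INR Q + 1 + 1) / 3); [|lra].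
      replace (PI / 2 / (INR Q + 1 + 1) / 3) with (PI / 2 * / (3 * (INR Q + 1 + 1)))
        by (field; lra).
      rewrite <- (Rmult_1_l (/ _)) at 1; apply Rmult_le_compat_r; [|lra].
      apply Rlt_le, Rinv_0_lt_compat; lra. }
pose proof (pos_INR P) as HP0.
rewrite <- (RInt_Chasles g 0 (PI / 2 / (INR P + 1)) (PI / 2)) by apply Hint.
rewrite Rmult_plus_distr_l, Rplus_comm; unfold plus; simpl.
apply Rplus_le_compat; [now apply Htail|].
replace (PI / 2 * (B / (INR P + 1))) with ((PI / 2 / (INR P + 1) - 0) * B) by (field; lra).
apply RInt_le_const; trivial.
apply Rlt_le, Rdiv_lt_0_compat; lra.
Qed.

(** The integral of a function that is only controlled through [|sin x|]: a
    bound [b p] proportional to [p] at the scale [|sin x| ~ 1/p] enters the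
    integral with weight [1/p], which is where logarithmic sums come from. *)
Lemma RInt_period_le (g : R -> R) (P : nat) (b : nat -> R) (B : R) :
  (forall x, continuous g x) ->
  (forall p x, (1 <= p <= P)%nat -> / (3 * (INR p + 1)) <= Rabs (sin x) -> g x <= b p) ->
  (forall x, g x <= B) ->
  RInt g (- PI) PI <=
    2 * PI * (sum_n_m (fun p => b p / (INR p * (INR p + 1))) 1 P + B / (INR P + 1)).
Proof.
intros Hg Hb HB.
set (S := (_ + _)).
assert (Hint : forall u v, ex_RInt g u v)
  by (intros; now apply ex_RInt_continuous_everywhere).
(* Each quarter of the period is carried onto the first one by a reflection or
   translation under which |sin| is invariant. *)
assert (Hquarter : forall u v, u = 1 \/ u = -1 ->
  (forall x, Rabs (sin (u * x + v)) = Rabs (sin x)) ->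
  RInt (fun x => g (u * x + v)) 0 (PI / 2) <= PI / 2 * S).
{ intros u v Hu Hs; apply RInt_quarter_le; auto.
  - intros x; apply (continuous_comp (fun x => u * x + v) g); auto.
    apply (ex_derive_continuous (V := R_NormedModule)); auto_derive; auto.
  - intros p x Hp Hx; apply (Hb p); auto; now rewrite Hs. }
assert (Hcomp : forall u v s t, u = 1 \/ u = -1 ->
   u * RInt (fun x => g (u * x + v)) s t = RInt g (u * s + v) (u * t + v)).
{ intros u v s t Hu; rewrite <- (RInt_comp_lin g u v s t) by apply Hint.
  symmetry; apply (RInt_scal (V := R_CompleteNormedModule)).
  apply ex_RInt_continuous_everywhere; intros x.
  apply (continuous_comp (fun x => u * x + v) g); auto.
  apply (ex_derive_continuous (V := R_NormedModule)); auto_derive; auto. }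
assert (Hswap : forall s t, RInt g t s = - RInt g s t)
  by (intros s t; rewrite <- (opp_RInt_swap g s t) by apply Hint; reflexivity).
rewrite <- (RInt_Chasles g (- PI) 0 PI) by apply Hint.
rewrite <- (RInt_Chasles g (- PI) (- (PI / 2)) 0) by apply Hint.
rewrite <- (RInt_Chasles g 0 (PI / 2) PI) by apply Hint.
unfold plus; simpl.
assert (H1 := Hquarter 1 0 ltac:(auto) ltac:(intros; do 2 f_equal; ring)).
assert (H2 := Hquarter (-1) 0 ltac:(auto) ltac:(intros;
   replace (-1 * x + 0) with (- x) by ring; now rewrite sin_neg, Rabs_Ropp)).
assert (H3 := Hquarter (-1) PI ltac:(auto) ltac:(intros;
   replace (-1 * x + PI) with (PI - x) by ring; now rewrite sin_PI_x)).
assert (H4 := Hquarter 1 (- PI) ltac:(auto) ltac:(intros;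
   replace (1 * x + - PI) with (- (PI - x)) by ring;
   now rewrite sin_neg, Rabs_Ropp, sin_PI_x)).
assert (C1 := Hcomp 1 0 0 (PI / 2) ltac:(auto)).
assert (C2 := Hcomp (-1) 0 0 (PI / 2) ltac:(auto)).
assert (C3 := Hcomp (-1) PI 0 (PI / 2) ltac:(auto)).
assert (C4 := Hcomp 1 (- PI) 0 (PI / 2) ltac:(auto)).
replace (1 * 0 + 0) with 0 in C1 by ring.
replace (1 * (PI / 2) + 0) with (PI / 2) in C1 by ring.
replace (-1 * 0 + 0) with 0 in C2 by ring.
replace (-1 * (PI / 2) + 0) with (- (PI / 2)) in C2 by ring.
replace (-1 * 0 + PI) with PI in C3 by ring.
replace (-1 * (PI / 2) + PI) with (PI / 2) in C3 by field.
replace (1 * 0 + - PI) with (- PI) in C4 by ring.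
replace (1 * (PI / 2) + - PI) with (- (PI / 2)) in C4 by field.
rewrite Hswap in C2, C3. lra.
Qed.

(** * Coefficients of general monotone sequences *)

Lemma half_bounds (n : nat) : (2 * (n / 2) <= n <= 2 * (n / 2) + 1)%nat.
Proof.
pose proof (Nat.div_mod_eq n 2); pose proof (Nat.mod_upper_bound n 2); lia.
Qed.

(** The chain [a_m, a_(m+2), ...] or [a_(m+1), a_(m+3), ...] that reaches [a_k]
    has all its steps among the differences summed on the right: its last step
    starts at [k - 2 <= 2m - 1]. *)
Lemma Cmod_le_step_two (a : nat -> C) (m k : nat) :
  (1 <= m)%nat -> (m <= k <= 2 * m + 1)%nat ->
  Cmod (a k) <= Cmod (a m) + Cmod (a (m + 1)%nat)
    + sum_n_m (fun i => Cmod (a i - a (i + 2)%nat)%C) m (2 * m - 1).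
Proof.
intros Hm Hk.
set (d := fun i => Cmod (a i - a (i + 2)%nat)%C).
assert (Hd : forall i, 0 <= d i) by (intros; apply Cmod_ge_0).
assert (Hsum : forall p q, 0 <= sum_n_m d p q) by (intros; now apply sum_R_nonneg).
assert (Hstep : forall i, Cmod (a (i + 2)%nat) <= Cmod (a i) + d i).
{ intros i; unfold d; rewrite <- (Cmod_opp (_ - _)).
  apply Rle_trans with (2 := Cmod_triangle _ _).
  apply Req_le; f_equal; ring. }
assert (H0 := Cmod_ge_0 (a m)); assert (H1 := Cmod_ge_0 (a (m + 1)%nat)).
(* Both parities are carried together so that the induction goes up by one. *)
assert (Hchain : forall j,
  Cmod (a (m + j + 2)%nat) <= Cmod (a m) + Cmod (a (m + 1)%nat) + sum_n_m d m (m + j) /\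
  Cmod (a (m + (j + 1) + 2)%nat) <= Cmod (a m) + Cmod (a (m + 1)%nat) + sum_n_m d m (m + (j + 1))).
{ induction j as [|j [IH1 IH2]].
  - rewrite !Nat.add_0_r, Nat.add_0_l, sum_n_n; split.
    + pose proof (Hstep m); lra.
    + replace (m + 1)%nat with (S m) by lia.
      rewrite sum_R_last, sum_n_n by lia.
      pose proof (Hstep (S m)); pose proof (Hd m).
      replace (m + 1)%nat with (S m) in * by lia; lra.
  - replace (S j) with (j + 1)%nat by lia; split; [exact IH2|].
    replace (m + (j + 1 + 1) + 2)%nat with (m + j + 2 + 2)%nat by lia.
    replace (m + (j + 1 + 1))%nat with (S (m + (j + 1))) by lia.
    pose proof (Hstep (m + j + 2)%nat).
    rewrite sum_R_last by lia.
    replace (m + (j + 1))%nat with (S (m + j)) in * by lia.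
    rewrite sum_R_last in * by lia.
    replace (S (S (m + j))) with (m + j + 2)%nat by lia.
    pose proof (Hd (S (m + j))); lra. }
assert (Hs := Hsum m (2 * m - 1)%nat).
destruct (Nat.eq_dec k m) as [->|]; [lra|].
destruct (Nat.eq_dec k (m + 1)) as [->|]; [lra|].
destruct (Hchain (k - m - 2)%nat) as [Hj _].
replace (m + (k - m - 2) + 2)%nat with k in Hj by lia.
rewrite (sum_R_Chasles d m (m + (k - m - 2)) (2 * m - 1)) by lia.
pose proof (Hsum (S (m + (k - m - 2))) (2 * m - 1)%nat); lra.
Qed.

(** At [k = n/2 + p] the denominator [2k - n + 2] is [2p + 1] or [2p + 2]
    (according to the parity of [n]), hence at most [4p]. *)
Lemma log_weighted_le (g : nat -> R) (n : nat) :
  (2 <= n)%nat -> (forall k, (1 <= k)%nat -> 0 <= g k) ->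
  sum_n_m (fun p => g (n / 2 + p)%nat / INR p) 1 (n - n / 2)
    <= 4 * sum_n_m (fun k => g k / (2 * INR k - INR n + 2)) (n / 2) (2 * n - 1).
Proof.
intros Hn Hg; pose proof (half_bounds n) as Hh; set (h := (n / 2)%nat) in *.
assert (HhR : 2 * INR h <= INR n <= 2 * INR h + 1).
{ destruct Hh as [Ha Hb]; apply le_INR in Ha; apply le_INR in Hb.
  rewrite plus_INR in Hb; rewrite !mult_INR in *; simpl in *; lra. }
set (w := fun k => g k / (2 * INR k - INR n + 2)).
assert (Hw : forall k, (h <= k)%nat -> 0 <= w k).
{ intros k Hk; apply Rmult_le_pos; [apply Hg; lia|].
  apply Rlt_le, Rinv_0_lt_compat; apply le_INR in Hk; lra. }
apply Rle_trans with (sum_n_m (fun p => 4 * w (h + p)%nat) 1 (n - h)).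
- apply sum_R_le; intros p Hp; unfold w.
  assert (Hp1 : 1 <= INR p) by (apply (le_INR 1); lia).
  rewrite plus_INR.
  replace (4 * (g (h + p)%nat / (2 * (INR h + INR p) - INR n + 2)))
    with (g (h + p)%nat * / ((2 * (INR h + INR p) - INR n + 2) / 4)) by (field; lra).
  apply Rmult_le_compat_l; [apply Hg; lia|].
  apply Rinv_le_contravar; lra.
- rewrite sum_R_scal; apply Rmult_le_compat_l; [lra|].
  rewrite sum_R_shift.
  rewrite (sum_R_first w h (2 * n - 1)) by lia.
  rewrite (sum_R_Chasles w (S h) (h + (n - h)) (2 * n - 1)) by lia.
  replace (h + 1)%nat with (S h) by lia.
  pose proof (Hw h ltac:(lia)).
  assert (0 <= sum_n_m w (S (h + (n - h))) (2 * n - 1))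
    by (apply sum_R_nonneg; intros; apply Hw; lia).
  lra.
Qed.

Definition harmonic (n : nat) : R := sum_n_m (fun p => / INR p) 1 n.

Lemma harmonic_S (n : nat) : harmonic (S n) = harmonic n + / (INR n + 1).
Proof. unfold harmonic; rewrite sum_R_last by lia; now rewrite S_INR. Qed.

Lemma harmonic_le (n m : nat) : (n <= m)%nat -> harmonic n <= harmonic m.
Proof.
induction 1 as [|m _ IH]; [lra|].
rewrite harmonic_S; pose proof (pos_INR m).
assert (0 < / (INR m + 1)) by (apply Rinv_0_lt_compat; lra); lra.
Qed.

Lemma harmonic_ge_1 (n : nat) : (1 <= n)%nat -> 1 <= harmonic n.
Proof.
intros Hn; apply Rle_trans with (2 := harmonic_le 1 n Hn).
unfold harmonic; rewrite sum_n_n; simpl; lra.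
Qed.

(** The terms between [q] and [2q] add at most [q * (1/q) = 1], which is at most
    the first term of the harmonic sum. *)
Lemma harmonic_double (q k : nat) :
  (1 <= q)%nat -> (k <= 2 * q)%nat -> harmonic k <= 2 * harmonic q.
Proof.
intros Hq Hk.
assert (Hq1 : 1 <= INR q) by (apply (le_INR 1); lia).
assert (H : forall j, harmonic (q + j) <= harmonic q + INR j * / INR q).
{ induction j as [|j IH].
  - rewrite Nat.add_0_r; simpl; lra.
  - rewrite Nat.add_succ_r, harmonic_S, S_INR, plus_INR.
    assert (/ (INR q + INR j + 1) <= / INR q)
      by (pose proof (pos_INR j); apply Rinv_le_contravar; lra).
    lra. }
apply Rle_trans with (1 := harmonic_le k (q + q) ltac:(lia)).
specialize (H q); rewrite Rinv_r in H by lra.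
pose proof (harmonic_ge_1 q Hq); lra.
Qed.

(** Every [m = k/2 + p] with [1 <= p <= k - k/2] satisfies [m <= k <= 2m + 1],
    so [|a_k|] is bounded by [(1 + K)] times the numerator of the hypothesis at
    [m]; weighting these bounds by [1/p] turns [|a_k|] into
    [|a_k|] times a harmonic sum, while the right side stays bounded by the sum
    in the hypothesis. *)
Lemma coefficient_log_le (beta : nat -> R) (a : nat -> C) (K : R) (k : nat) :
  nonneg_seq beta -> 0 <= K ->
  (forall m, (1 <= m)%nat ->
     sum_n_m (fun n => Cmod (a n - a (n + 2)%nat)%C) m (2 * m - 1) <= K * beta m) ->
  (2 <= k)%nat ->
  Cmod (a k) * harmonic (k - k / 2) <= 4 * (1 + K) *
    sum_n_m (fun j => (beta j + beta (2 * j)%nat + Cmod (a j) + Cmod (a (j + 1)%nat))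
               / (2 * INR j - INR k + 2)) (k / 2) (2 * k - 1).
Proof.
intros Hbeta HK HG Hk.
set (g := fun j => beta j + beta (2 * j)%nat + Cmod (a j) + Cmod (a (j + 1)%nat)).
assert (Hg : forall j, (1 <= j)%nat -> 0 <= g j).
{ intros j Hj; unfold g.
  pose proof (Hbeta j Hj); pose proof (Hbeta (2 * j)%nat ltac:(lia)).
  pose proof (Cmod_ge_0 (a j)); pose proof (Cmod_ge_0 (a (j + 1)%nat)); lra. }
pose proof (log_weighted_le g k Hk Hg) as HW.
pose proof (half_bounds k) as Hh; set (h := (k / 2)%nat) in *.
apply Rle_trans with ((1 + K) * sum_n_m (fun p => g (h + p)%nat / INR p) 1 (k - h));
  [|rewrite Rmult_comm, (Rmult_comm 4), Rmult_assoc, Rmult_comm;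
    apply Rmult_le_compat_l; [lra|exact HW]].
unfold harmonic; rewrite <- !sum_R_scal.
apply sum_R_le; intros p Hp; unfold Rdiv; rewrite <- Rmult_assoc.
apply Rmult_le_compat_r.
- apply Rlt_le, Rinv_0_lt_compat, (lt_INR 0); lia.
- pose proof (Cmod_le_step_two a (h + p) k ltac:(lia) ltac:(lia)).
  pose proof (HG (h + p)%nat ltac:(lia)); unfold g.
  pose proof (Hbeta (h + p)%nat ltac:(lia)).
  pose proof (Hbeta (2 * (h + p))%nat ltac:(lia)).
  pose proof (Cmod_ge_0 (a (h + p)%nat)); pose proof (Cmod_ge_0 (a (h + p + 1)%nat)).
  nra.
Qed.

(** * The upper half of the sum *)

(** For [c_k = k a_k], the difference [c_k - c_(k+2)] is
    [k (a_k - a_(k+2)) - 2 a_(k+2)].  The second parts contribute at most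
    [2 n alpha], and the four boundary terms of the summation by parts at most
    [(4n + 4) alpha <= 8 n alpha]. *)
Lemma tail_sum_le (a : nat -> C) (m n : nat) (alpha x : R) :
  (1 <= m <= n)%nat -> (forall k, (m <= k <= n + 2)%nat -> Cmod (a k) <= alpha) ->
  2 * Rabs (sin x) * Cmod (cos_sum (fun k => RtoC (INR k) * a k)%C m n x) <=
    INR n * sum_n_m (fun k => Cmod (a k - a (k + 2)%nat)%C) m n + 10 * INR n * alpha.
Proof.
intros Hm Ha.
assert (Halpha : 0 <= alpha)
  by (apply Rle_trans with (1 := Cmod_ge_0 (a m)), Ha; lia).
assert (Hn1 : 1 <= INR n) by (apply (le_INR 1); lia).
set (c := fun k => (RtoC (INR k) * a k)%C).
assert (Hsin : forall z y, Cmod (z * RtoC (sin y)) <= Cmod z).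
{ intros z y; rewrite Cmod_mult, Cmod_R; apply Rle_trans with (Cmod z * 1); [|lra].
  apply Rmult_le_compat_l; [apply Cmod_ge_0|].
  apply Rabs_le; pose proof (SIN_bound y); lra. }
assert (Hc : forall k, (m <= k <= n + 2)%nat -> Cmod (c k) <= INR k * alpha).
{ intros k Hk; unfold c; rewrite Cmod_mult, Cmod_R, (Rabs_pos_eq (INR k)) by apply pos_INR.
  apply Rmult_le_compat_l; [apply pos_INR|now apply Ha]. }
assert (E : 2 * Rabs (sin x) * Cmod (cos_sum c m n x)
  = Cmod (RtoC (2 * sin x) * cos_sum c m n x)).
{ rewrite Cmod_mult, Cmod_R, Rabs_mult, (Rabs_pos_eq 2) by lra; reflexivity. }
rewrite E, abel_step_two by lia; clear E.
set (D := sum_n_m _ m n) at 1.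
assert (HD : Cmod D <= INR n * sum_n_m (fun k => Cmod (a k - a (k + 2)%nat)%C) m n
    + 2 * INR n * alpha).
{ apply Rle_trans with (1 := Cmod_sum_le _ _ _).
  apply Rle_trans with
    (sum_n_m (fun k => INR n * Cmod (a k - a (k + 2)%nat)%C + 2 * alpha) m n).
  - apply sum_R_le; intros k Hk; apply Rle_trans with (1 := Hsin _ _).
    unfold c; rewrite plus_INR; change (INR 2) with 2.
    replace (RtoC (INR k) * a k - RtoC (INR k + 2) * a (k + 2)%nat)%C
      with (RtoC (INR k) * (a k - a (k + 2)%nat) + - (RtoC 2 * a (k + 2)%nat))%C
      by (rewrite RtoC_plus; ring).
    apply Rle_trans with (1 := Cmod_triangle _ _); rewrite Cmod_opp, !Cmod_mult, !Cmod_R.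
    rewrite (Rabs_pos_eq 2), (Rabs_pos_eq (INR k)) by (apply pos_INR || lra).
    apply Rplus_le_compat.
    + apply Rmult_le_compat_r; [apply Cmod_ge_0|apply le_INR; lia].
    + apply Rmult_le_compat_l; [lra|apply Ha; lia].
  - rewrite sum_R_plus, sum_R_scal, sum_n_m_const.
    assert (INR (S n - m) <= INR n) by (apply le_INR; lia).
    nra. }
pose proof (Hc m ltac:(lia)) as H1; pose proof (Hc (m + 1)%nat ltac:(lia)) as H2.
pose proof (Hc (n + 1)%nat ltac:(lia)) as H3; pose proof (Hc (n + 2)%nat ltac:(lia)) as H4.
rewrite !plus_INR in H2, H3, H4; simpl in H2, H3, H4.
assert (HmR : INR m <= INR n) by (apply le_INR; lia).
pose proof (Hsin (c (n + 1)%nat) (INR n * x)).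
pose proof (Hsin (c (n + 2)%nat) ((INR n + 1) * x)).
pose proof (Hsin (c m) ((INR m - 1) * x)).
pose proof (Hsin (c (m + 1)%nat) (INR m * x)).
unfold Cminus at 1.
pose proof (Cmod_triangle (D + (c (n + 1)%nat * RtoC (sin (INR n * x))
      + c (n + 2)%nat * RtoC (sin ((INR n + 1) * x))))
   (- (c m * RtoC (sin ((INR m - 1) * x)) + c (m + 1)%nat * RtoC (sin (INR m * x))))) as T1.
pose proof (Cmod_triangle D (c (n + 1)%nat * RtoC (sin (INR n * x))
      + c (n + 2)%nat * RtoC (sin ((INR n + 1) * x)))) as T2.
pose proof (Cmod_triangle (c (n + 1)%nat * RtoC (sin (INR n * x)))
      (c (n + 2)%nat * RtoC (sin ((INR n + 1) * x)))) as T3.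
pose proof (Cmod_triangle (c m * RtoC (sin ((INR m - 1) * x)))
      (c (m + 1)%nat * RtoC (sin (INR m * x)))) as T4.
rewrite Cmod_opp in T1.
apply Rle_trans with (1 := T1).
assert (INR m * alpha <= INR n * alpha) by (apply Rmult_le_compat_r; lra).
assert (alpha <= INR n * alpha) by nra.
lra.
Qed.

(** The [p]-dependent bound passed to [RInt_period_le] is the trivial bound for
    the terms with indices in [(h, h + p)] plus the summation-by-parts bound for
    those with indices in [[h + p, n]], where [h = n/2].  The choice [h = n/2]
    makes [n <= 2 (h + p) - 1], so one sum of differences starting at [h + p]
    covers the rest of the block. *)
Lemma block_integral_le (beta : nat -> R) (a : nat -> C) (K alpha : R) (n : nat) :
  nonneg_seq beta -> 0 <= K ->
  (forall m, (1 <= m)%nat ->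
     sum_n_m (fun n => Cmod (a n - a (n + 2)%nat)%C) m (2 * m - 1) <= K * beta m) ->
  (2 <= n)%nat ->
  (forall k, (n / 2 + 1 <= k <= n + 2)%nat -> Cmod (a k) <= alpha) ->
  RInt (fun x => Cmod (cos_sum (fun k => RtoC (INR k) * a k)%C (n / 2 + 1) n x)) (- PI) PI
  <= 2 * PI * INR n * (17 * (alpha * harmonic (n - n / 2))
       + 2 * K * sum_n_m (fun p => beta (n / 2 + p)%nat / INR p) 1 (n - n / 2)).
Proof.
intros Hbeta HK HG Hn Ha; pose proof PI_RGT_0 as HPI.
pose proof (half_bounds n) as Hh; set (h := (n / 2)%nat) in *.
assert (Halpha : 0 <= alpha)
  by (apply Rle_trans with (1 := Cmod_ge_0 (a n)), Ha; lia).
assert (Hn1 : 1 <= INR n) by (apply (le_INR 1); lia).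
set (c := fun k => (RtoC (INR k) * a k)%C); set (P := (n - h)%nat).
assert (Hpart : forall q x, (q <= P)%nat ->
  Cmod (cos_sum c (h + 1) (h + q) x) <= INR q * (INR n * alpha)).
{ intros q x Hq; apply Rle_trans with (1 := Cmod_sum_le _ _ _).
  replace (INR q) with (INR (S (h + q) - (h + 1))) by (f_equal; lia).
  rewrite <- sum_n_m_const; apply sum_R_le; intros k Hk.
  unfold c; rewrite !Cmod_mult, !Cmod_R, (Rabs_pos_eq (INR k)) by apply pos_INR.
  rewrite <- (Rmult_1_r (INR n * alpha)).
  apply Rmult_le_compat; try apply Rabs_pos.
  - apply Rmult_le_pos; [apply pos_INR|apply Cmod_ge_0].
  - apply Rmult_le_compat; try apply pos_INR; try apply Cmod_ge_0.
    + apply le_INR; lia.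
    + apply Ha; lia.
  - apply Rabs_le; pose proof (COS_bound (INR k * x)); lra. }
apply Rle_trans with (2 * PI * (sum_n_m (fun p =>
    (INR p * (INR n * alpha)
      + 3 / 2 * (INR p + 1) * (INR n * (K * beta (h + p)%nat) + 10 * INR n * alpha))
    / (INR p * (INR p + 1))) 1 P + INR P * (INR n * alpha) / (INR P + 1))).
- apply RInt_period_le.
  + intros x; apply continuous_Cmod_cos_sum.
  + (* The block is cut at [m = h + p], the cut adapted to the size of [sin x]. *)
    intros p x Hp Hx; set (m := (h + p)%nat).
    assert (Hp1 : 1 <= INR p) by (apply (le_INR 1); lia).
    assert (E : cos_sum c (h + 1) n x
      = (cos_sum c (h + 1) (h + (p - 1)) x + cos_sum c m n x)%C).
    { unfold cos_sum, m; rewrite (sum_C_Chasles _ (h + 1) (h + (p - 1)) n) by lia.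
      now replace (S (h + (p - 1))) with (h + p)%nat by lia. }
    rewrite E; apply Rle_trans with (1 := Cmod_triangle _ _); apply Rplus_le_compat.
    * apply Rle_trans with (1 := Hpart (p - 1)%nat x ltac:(lia)).
      apply Rmult_le_compat_r; [nra|apply le_INR; lia].
    * pose proof (tail_sum_le a m n alpha x ltac:(lia) ltac:(intros; apply Ha; lia)) as HT.
      fold c in HT.
      assert (HV : sum_n_m (fun k => Cmod (a k - a (k + 2)%nat)%C) m n <= K * beta m).
      { apply Rle_trans with (2 := HG m ltac:(lia)).
        rewrite (sum_R_Chasles _ m n (2 * m - 1)) by lia.
        rewrite <- (Rplus_0_r (sum_n_m _ m n)) at 1; apply Rplus_le_compat_l.
        apply sum_R_nonneg; intros; apply Cmod_ge_0. }
      set (z := Cmod (cos_sum c m n x)) in *.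
      assert (Hz : 0 <= z) by apply Cmod_ge_0.
      assert (HX : 2 * Rabs (sin x) * z <= INR n * (K * beta m) + 10 * INR n * alpha).
      { apply Rle_trans with (1 := HT), Rplus_le_compat_r.
        apply Rmult_le_compat_l; lra. }
      assert (H1 : 1 <= 3 * (INR p + 1) * Rabs (sin x)).
      { apply Rle_trans with (3 * (INR p + 1) * / (3 * (INR p + 1)));
          [rewrite Rinv_r; lra|].
        apply Rmult_le_compat_l; lra. }
      apply Rle_trans with (3 * (INR p + 1) * Rabs (sin x) * z); [nra|].
      replace (3 * (INR p + 1) * Rabs (sin x) * z)
        with (3 / 2 * (INR p + 1) * (2 * Rabs (sin x) * z)) by field.
      apply Rmult_le_compat_l; lra.
  + intros x; replace n with (h + P)%nat at 1 by lia; now apply Hpart.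
- rewrite (Rmult_assoc (2 * PI)); apply Rmult_le_compat_l; [lra|].
  apply Rle_trans with
    (sum_n_m (fun p => 16 * INR n * alpha * / INR p
               + 2 * INR n * K * (beta (h + p)%nat / INR p)) 1 P + INR n * alpha).
  + apply Rplus_le_compat.
    * apply sum_R_le; intros p Hp.
      assert (Hp1 : 1 <= INR p) by (apply (le_INR 1); lia).
      pose proof (Hbeta (h + p)%nat ltac:(lia)) as Hb.
      assert (Hip : 0 <= / INR p) by (apply Rlt_le, Rinv_0_lt_compat; lra).
      assert (Hip1 : / (INR p + 1) <= / INR p) by (apply Rinv_le_contravar; lra).
      replace ((INR p * (INR n * alpha) + 3 / 2 * (INR p + 1) *
         (INR n * (K * beta (h + p)%nat) + 10 * INR n * alpha)) / (INR p * (INR p + 1)))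
        with (INR n * alpha * / (INR p + 1)
          + 3 / 2 * (INR n * (K * beta (h + p)%nat) + 10 * INR n * alpha) * / INR p)
        by (field; lra).
      assert (INR n * alpha * / (INR p + 1) <= INR n * alpha * / INR p)
        by (apply Rmult_le_compat_l; [nra|lra]).
      assert (0 <= INR n * (K * beta (h + p)%nat) * / INR p)
        by (repeat apply Rmult_le_pos; lra).
      unfold Rdiv; lra.
    * pose proof (pos_INR P).
      apply Rmult_le_reg_r with (INR P + 1); [lra|].
      unfold Rdiv; rewrite Rmult_assoc, Rinv_l by lra.
      assert (0 <= INR n * alpha) by nra; nra.
  + rewrite sum_R_plus, !sum_R_scal; fold (harmonic P).
    pose proof (harmonic_ge_1 P ltac:(lia)).
    assert (INR n * alpha <= INR n * alpha * harmonic P)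
      by (assert (0 <= INR n * alpha) by nra; nra).
    lra.
Qed.

(** * Conclusion *)

(** Iterating the hypothesis halves the error [eps * n] at each step, so the
    errors form a geometric series of sum at most [2 eps n]. *)
Lemma halving_little_o (t : nat -> R) :
  (forall n, 0 <= t n) ->
  (forall eps, 0 < eps -> exists N, forall n, (N <= n)%nat ->
     t n <= t (n / 2)%nat + eps * INR n) ->
  is_lim_seq (fun n => t n / (INR n + 1)) 0.
Proof.
intros Ht H; apply is_lim_seq_spec; intros eps.
destruct (H (eps / 4) ltac:(pose proof (cond_pos eps); lra)) as [N HN].
pose proof (cond_pos eps) as Heps.
assert (HB : exists B, 0 <= B /\ forall k, (k <= N)%nat -> t k <= B).
{ clear HN; induction N as [|N [B [HB0 HB]]].
  - exists (t 0%nat); split; [apply Ht|]; intros k Hk; replace k with 0%nat by lia; lra.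
  - exists (B + t (S N)); pose proof (Ht (S N)); split; [lra|]; intros k Hk.
    destruct (Nat.eq_dec k (S N)) as [->|]; [lra|].
    pose proof (HB k ltac:(lia)); lra. }
destruct HB as [B [HB0 HB]].
assert (Hlin : forall n, t n <= B + eps / 2 * INR n).
{ intros n; induction n as [n IH] using lt_wf_ind.
  destruct (le_lt_dec n N) as [Hn|Hn].
  - pose proof (HB n Hn); pose proof (pos_INR n); nra.
  - pose proof (half_bounds n) as Hh.
    apply Rle_trans with (1 := HN n ltac:(lia)).
    pose proof (IH (n / 2)%nat ltac:(lia)).
    assert (2 * INR (n / 2) <= INR n)
      by (destruct Hh as [Hh _]; apply le_INR in Hh; rewrite mult_INR in Hh; exact Hh).
    nra. }
destruct (nfloor_ex (2 * B / eps)) as [M HM].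
{ apply Rmult_le_pos; [lra|]; apply Rlt_le, Rinv_0_lt_compat; lra. }
exists (S M); intros n Hn.
assert (HMn : INR M + 1 <= INR n) by (rewrite <- S_INR; apply le_INR; lia).
pose proof (pos_INR M).
rewrite Rminus_0_r, Rabs_pos_eq
  by (apply Rmult_le_pos; [apply Ht|apply Rlt_le, Rinv_0_lt_compat; lra]).
apply Rmult_lt_reg_r with (INR n + 1); [lra|].
unfold Rdiv; rewrite Rmult_assoc, Rinv_l, Rmult_1_r by lra.
apply Rle_lt_trans with (1 := Hlin n).
assert (HB2 : 2 * B < eps * (INR M + 1)).
{ apply Rmult_lt_reg_r with (/ eps); [now apply Rinv_0_lt_compat|].
  replace (eps * (INR M + 1) * / eps) with (INR M + 1) by (field; lra).
  unfold Rdiv in HM; lra. }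
nra.
Qed.

Theorem theorem3 (beta : nat -> R) (a : nat -> C)
  (Hbeta : nonneg_seq beta) (Ha : GM beta 2 a)
  (Hsum : is_lim_seq
     (fun n : nat =>
        sum_n_m
          (fun k : nat =>
             (beta k + beta (2 * k)%nat + Cmod (a k) + Cmod (a (k + 1)%nat))
               / (2 * INR k - INR n + 2))
          (n / 2)%nat (2 * n - 1)%nat)
     0) :
  is_lim_seq
    (fun n : nat =>
       L1norm (fun x : R => (cos_fejer_mean a n x - cos_partial_sum a n x)%C))
    0.
Proof.
pose proof PI_RGT_0 as HPI.
destruct Ha as [K0 HG0].
assert (HG : exists K, 0 <= K /\ forall m, (1 <= m)%nat ->
   sum_n_m (fun n => Cmod (a n - a (n + 2)%nat)%C) m (2 * m - 1) <= K * beta m).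
{ (* Since [beta_m >= 0], the constant may be taken nonnegative. *)
  exists (Rabs K0); split; [apply Rabs_pos|]; intros m Hm.
  apply Rle_trans with (1 := HG0 m Hm), Rmult_le_compat_r; [now apply Hbeta|apply Rle_abs]. }
clear K0 HG0; destruct HG as [K [HK HG]].
set (g := fun k => beta k + beta (2 * k)%nat + Cmod (a k) + Cmod (a (k + 1)%nat)) in *.
set (H := fun n => sum_n_m (fun k => g k / (2 * INR k - INR n + 2)) (n / 2) (2 * n - 1)).
set (c := fun k => (RtoC (INR k) * a k)%C).
set (t := fun n => RInt (fun x => Cmod (cos_sum c 1 n x)) (- PI) PI).
assert (Hint : forall m n u v, ex_RInt (fun x => Cmod (cos_sum c m n x)) u v)
  by (intros; apply ex_RInt_continuous_everywhere; intros; apply continuous_Cmod_cos_sum).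
apply is_lim_seq_ext with (fun n => / (2 * PI) * (t n / (INR n + 1))).
{ intros n; unfold L1norm; f_equal; unfold t.
  pose proof (pos_INR n).
  unfold Rdiv; rewrite Rmult_comm, <- (RInt_scal (V := R_CompleteNormedModule)) by apply Hint.
  apply RInt_ext; intros x _; rewrite partial_minus_fejer, Cmod_opp, Cmod_mult, Cmod_R.
  rewrite Rabs_pos_eq by (apply Rlt_le, Rinv_0_lt_compat; lra); reflexivity. }
replace (Finite 0) with (Rbar_mult (/ (2 * PI)) 0) by (simpl; f_equal; ring).
apply is_lim_seq_scal_l, halving_little_o.
{ intros n; apply RInt_ge_0; [lra|apply Hint|intros; apply Cmod_ge_0]. }
intros eps Heps.
(* The block will be at most
   [2 PI n (17 * 8 (1 + K) + 2 K * 4) delta <= 2 PI n * 144 (1 + K) delta]. *)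
set (delta := eps / (2 * PI * (144 * (1 + K)))).
assert (Hden : 0 < 2 * PI * (144 * (1 + K))) by nra.
assert (Hdelta : 0 < delta) by now apply Rdiv_lt_0_compat.
apply is_lim_seq_spec in Hsum; destruct (Hsum (mkposreal delta Hdelta)) as [N HN].
assert (HH : forall n, (N <= n)%nat -> H n <= delta).
{ intros n Hn; specialize (HN n Hn); simpl in HN; rewrite Rminus_0_r in HN.
  apply Rlt_le, Rle_lt_trans with (2 := HN), Rle_abs. }
clear HN.
(* The coefficients of the block have indices above [n/2], and the hypothesis is
   used at these indices as well as at [n]; hence the factor 2. *)
exists (2 * N + 4)%nat; intros n Hn.
pose proof (half_bounds n) as Hh.
pose proof (harmonic_ge_1 (n - n / 2) ltac:(lia)) as HL.
set (alpha := 8 * (1 + K) * delta / harmonic (n - n / 2)).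
assert (Halpha : forall k, (n / 2 + 1 <= k <= n + 2)%nat -> Cmod (a k) <= alpha).
{ intros k Hk; pose proof (half_bounds k) as Hhk.
  assert (Hk1 := coefficient_log_le beta a K k Hbeta HK HG ltac:(lia)).
  change (Cmod (a k) * harmonic (k - k / 2) <= 4 * (1 + K) * H k) in Hk1.
  assert (Hk2 := HH k ltac:(lia)).
  assert (Hk3 : harmonic (n - n / 2) <= 2 * harmonic (k - k / 2)).
  { apply Rle_trans with (harmonic k); [apply harmonic_le; lia|].
    apply harmonic_double; lia. }
  pose proof (Cmod_ge_0 (a k)).
  apply Rmult_le_reg_r with (harmonic (n - n / 2)); [lra|].
  unfold alpha, Rdiv; rewrite Rmult_assoc, Rinv_l, Rmult_1_r by lra.
  assert (4 * (1 + K) * H k <= 4 * (1 + K) * delta) by (apply Rmult_le_compat_l; lra).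
  nra. }
apply Rle_trans with (t (n / 2)%nat
  + RInt (fun x => Cmod (cos_sum c (n / 2 + 1) n x)) (- PI) PI).
{ unfold t.
  change (_ + _) with (plus (RInt (fun x => Cmod (cos_sum c 1 (n / 2) x)) (- PI) PI)
     (RInt (fun x => Cmod (cos_sum c (n / 2 + 1) n x)) (- PI) PI)).
  rewrite <- (RInt_plus (V := R_CompleteNormedModule)) by apply Hint.
  apply RInt_le; [lra|apply Hint|apply (ex_RInt_plus (V := R_NormedModule)); apply Hint|].
  intros x _; unfold plus; simpl.
  unfold cos_sum at 1; rewrite (sum_C_Chasles _ 1 (n / 2) n) by lia.
  replace (S (n / 2)) with (n / 2 + 1)%nat by lia.
  apply Cmod_triangle. }
apply Rplus_le_compat_l.
apply Rle_trans with (1 := block_integral_le beta a K alpha n Hbeta HK HG ltac:(lia) Halpha).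
assert (Hb : sum_n_m (fun p => beta (n / 2 + p)%nat / INR p) 1 (n - n / 2) <= 4 * delta).
{ apply Rle_trans with (sum_n_m (fun p => g (n / 2 + p)%nat / INR p) 1 (n - n / 2)).
  - apply sum_R_le; intros p Hp; apply Rmult_le_compat_r.
    + apply Rlt_le, Rinv_0_lt_compat, (lt_INR 0); lia.
    + unfold g; pose proof (Hbeta (2 * (n / 2 + p))%nat ltac:(lia)).
      pose proof (Cmod_ge_0 (a (n / 2 + p)%nat)).
      pose proof (Cmod_ge_0 (a (n / 2 + p + 1)%nat)); lra.
  - apply Rle_trans with (4 * H n).
    + apply log_weighted_le; [lia|]; intros k Hk; unfold g.
      pose proof (Hbeta k Hk); pose proof (Hbeta (2 * k)%nat ltac:(lia)).
      pose proof (Cmod_ge_0 (a k)); pose proof (Cmod_ge_0 (a (k + 1)%nat)); lra.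
    + pose proof (HH n ltac:(lia)); lra. }
replace (alpha * harmonic (n - n / 2)) with (8 * (1 + K) * delta)
  by (unfold alpha; field; lra).
replace (eps * INR n) with (2 * PI * INR n * (144 * (1 + K) * delta))
  by (unfold delta; field; lra).
apply Rmult_le_compat_l; [pose proof (pos_INR n); nra|].
assert (K * sum_n_m (fun p => beta (n / 2 + p)%nat / INR p) 1 (n - n / 2)
  <= K * (4 * delta)) by now apply Rmult_le_compat_l.
nra.
Qed.
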